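(* The function $\zeta_2(s,s)$ has no zero in $\{s\in\mathbb{C} \mid \operatorname{Re} s>\sigma_b\}$.
   Context: The Euler double zeta-function is $\zeta_2(s_1,s_2)=\sum_{n_1=1}^{\infty}\sum_{n_2=1}^{\infty}\frac{1}{n_1^{s_1}(n_1+n_2)^{s_2}}$, absolutely convergent for $\operatorname{Re}(s_1+s_2)>2$, $\operatorname{Re} s_2>1$, and continued meromorphically to $\mathbb{C}^2$. The function $\zeta_2(s,s)$ of one complex variable $s$ is obtained by putting $s_1=s_2=s$; it is the meromorphic function on $\mathbb{C}$ satisfying $\zeta_2(s,s)=\frac12\left(\zeta(s)^2-\zeta(2s)\right)$, where $\zeta$ is the Riemann zeta-function. Let $p_n$ denote the $n$-th prime. For $\sigma>1$ put $\theta_n=\theta_n(\sigma)=\arg\frac{1+i/p_n^{\sigma}}{1-i/p_n^{\sigma}}=2\arctan(p_n^{-\sigma})$ $(n\ge 1)$ and $g(\sigma)=\theta_1-\sum_{n\ge 2}\theta_n$. The number $\sigma_b=1.8018642\cdots$ is the unique zero of $g$ in $(1,\infty)$. *)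

(* Defs.v *)
From Stdlib Require Import Reals.
From Coquelicot Require Import Coquelicot.
From mathcomp Require ssrnat prime.

Open Scope R_scope.

Definition Cexp (z : C) : C :=
  (exp (Re z) * cos (Im z), exp (Re z) * sin (Im z)).

(* [x ^ s = exp (s * log x)] with the real logarithm; meaningful for [0 < x]. *)
Definition Cpower (x : R) (s : C) : C := Cexp (s * RtoC (ln x)).

(* Limits in [C] are componentwise.  Like [Series], this is total and only
   meaningful on convergent series. *)
Definition CSeries (a : nat -> C) : C :=
  (Series (fun n => Re (a n)), Series (fun n => Im (a n))).

(* Euler double zeta-function on its half-space of absolute convergence,
   [2 < Re (s1 + s2)] and [1 < Re s2], where the order of summation is
   immaterial; no claim is made outside it.  On the diagonal this is [1 < Re s].
   The summation indices, usually [>= 1], are [S n1] and [S n2]. *)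
Definition zeta2 (s1 s2 : C) : C :=
  CSeries (fun n1 => CSeries (fun n2 =>
    (/ (Cpower (INR (S n1)) s1 * Cpower (INR (S n1 + S n2)) s2))%C)).

Lemma ex_prime_above (m : nat) :
  exists p : nat, is_true (andb (ssrnat.leq (S m) p) (prime.prime p)).
Proof.
  destruct (prime.prime_above m) as [p Hmp Hp].
  exists p. now rewrite Hmp, Hp.
Qed.

Definition next_prime (m : nat) : nat := ssrnat.ex_minn (ex_prime_above m).

(* Numbered from 0: [nth_prime 0 = 2], so that [p_n] is [nth_prime (n - 1)]. *)
Fixpoint nth_prime (n : nat) : nat :=
  match n with
  | O => 2%nat
  | S k => next_prime (nth_prime k)
  end.

(* The argument of [(1 + i / p ^ sigma) / (1 - i / p ^ sigma)], with
   [p = nth_prime n]. *)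
Definition theta (n : nat) (sigma : R) : R :=
  2 * atan (Rpower (INR (nth_prime n)) (- sigma)).

Definition g (sigma : R) : R :=
  theta 0 sigma - Series (fun n => theta (S n) sigma).

(* Main.v *)
Require Import Defs.
From Stdlib Require Import Reals Lra Lia.
From Coquelicot Require Import Coquelicot.
From mathcomp Require Import all_boot zify.

Open Scope R_scope.

(** Why the theorem holds.  Write [z_p = p ^ (- s)] and let [zeta] be the Riemann
    zeta-function.  Since [zeta2 s s = (zeta s ^ 2 - zeta (2 s)) / 2]
    ([zeta2_diagonal]), a zero means [zeta s ^ 2 = zeta (2 s)], and by the Euler
    products of both sides ([euler_product]) this says that the product over all
    primes of [(1 + z_p) / (1 - z_p)] is [1].

    To a complex number [X] attach [Z = (X - 1) / (X + 1)], the hyperbolic tangent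
    of [ln X / 2]; for the factor [(1 + z_p) / (1 - z_p)] this is [z_p] itself.
    A product of such numbers has [Z' = (Z1 + Z2) / (1 + Z1 Z2)], hence
    [|Z'| <= (|Z1| + |Z2|) / (1 - |Z1| |Z2|)], which is the addition theorem of
    [tan]: the angles [2 atan |Z|] are subadditive ([tanh_add_le_tan_add],
    [prod_tanh_bound]).  In particular neither complex logarithms nor a choice of
    their branches enter.

    Now [X] and [1 / X] have the same angle.  If the whole product is [1], the
    factor of the prime [2] is the inverse of the product of all the others, so
    the angle of [2] is at most the sum of the other angles
    ([first_factor_bound]).  At abscissa [sigma_b] these two are equal, by the
    equation [g sigma_b = 0].  Moving to [Re s = sigma_b + d] with [d > 0]
    multiplies [|z_2|] by [2 ^ (- d)] but each other [|z_p|] by at most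
    [mu = 3 ^ (- d)], which is smaller.  The addition theorem above keeps such a
    common factor [mu <= 1] outside the tangent, so the other primes reach at
    most [mu] times the tangent at [sigma_b], that is [mu * 2 ^ (- sigma_b)],
    which is less than [|z_2| = 2 ^ (- d) * 2 ^ (- sigma_b)]: a contradiction. *)

(** * Limits and series of complex numbers *)

Definition Clim (u : nat -> C) (l : C) : Prop :=
  filterlim u eventually (@locally C_NormedModule l).

Definition Cis_series (a : nat -> C) (l : C) : Prop :=
  @is_series C_AbsRing C_NormedModule a l.

Lemma Clim_ext u v l : (forall n, u n = v n) -> Clim u l -> Clim v l.
Proof. intros E; exact (filterlim_ext u v E). Qed.

Lemma Clim_const c : Clim (fun _ => c) c.
Proof. exact (filterlim_const c). Qed.

Lemma Clim_shift u l : Clim u l -> Clim (fun n => u (S n)) l.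
Proof.
intros H; apply (filterlim_comp _ _ _ S u _ eventually); [|exact H].
apply eventually_subseq; intros n; lia.
Qed.

Lemma Clim_plus u v a b :
  Clim u a -> Clim v b -> Clim (fun n => u n + v n)%C (a + b)%C.
Proof.
intros Hu Hv.
apply (filterlim_comp_2 _ _ _ Hu Hv).
exact (@filterlim_plus C_AbsRing C_NormedModule a b).
Qed.

Lemma Clim_opp u a : Clim u a -> Clim (fun n => - u n)%C (- a)%C.
Proof.
intros Hu; apply (filterlim_comp _ _ _ _ _ _ _ _ Hu).
exact (@filterlim_opp C_AbsRing C_NormedModule a).
Qed.

Lemma Clim_minus u v a b :
  Clim u a -> Clim v b -> Clim (fun n => u n - v n)%C (a - b)%C.
Proof. intros Hu Hv; apply Clim_plus; [exact Hu|now apply Clim_opp]. Qed.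

Lemma Clim_mult u v a b :
  Clim u a -> Clim v b -> Clim (fun n => u n * v n)%C (a * b)%C.
Proof.
intros Hu Hv P HP.
assert (H : filterlim (fun n => mult (u n : C_AbsRing) (v n)) eventually
  (@locally (AbsRing_UniformSpace C_AbsRing) (mult (a : C_AbsRing) b))).
{ apply (filterlim_comp_2 (F := eventually)
    (G := @locally (AbsRing_UniformSpace C_AbsRing) a)
    (H := @locally (AbsRing_UniformSpace C_AbsRing) b)).
  - intros Q HQ; apply Hu; now apply locally_C.
  - intros Q HQ; apply Hv; now apply locally_C.
  - apply filterlim_mult. }
apply H; now apply locally_C.
Qed.

Lemma Clim_Cmod u l : Clim u l -> is_lim_seq (fun n => Cmod (u n)) (Cmod l).
Proof.
intros Hu; unfold is_lim_seq.
change (filterlim (fun n => Cmod (u n)) eventually (locally (Cmod l))).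
apply (filterlim_comp _ _ _ _ Cmod _ _ _ Hu).
intros P HP; exact (@filterlim_norm C_AbsRing C_NormedModule l P HP).
Qed.

Lemma Clim_bound u l (b : nat -> R) :
  (forall n, Cmod (u n - l) <= b n) -> is_lim_seq b 0 -> Clim u l.
Proof.
intros Hb H0.
assert (Hd : Clim (fun n => u n - l)%C 0%C).
{ apply (@filterlim_norm_zero nat C_AbsRing C_NormedModule eventually _).
  change (is_lim_seq (fun n => Cmod (u n - l)%C) 0).
  apply is_lim_seq_le_le with (u := fun _ => 0) (w := b);
    [|apply is_lim_seq_const|exact H0].
  intros n; split; [apply Cmod_ge_0|apply Hb]. }
apply (Clim_ext (fun n => u n - l + l)%C); [intros n; ring|].
rewrite -{3}(Cplus_0_l l).
apply Clim_plus; [exact Hd|apply Clim_const].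
Qed.

Lemma Cis_series_lim a l : Cis_series a l -> Clim (sum_n a) l.
Proof. intros H; exact H. Qed.

Lemma Cis_series_ext a b l :
  (forall n, a n = b n) -> Cis_series a l -> Cis_series b l.
Proof. intros E; exact (is_series_ext a b l E). Qed.

Lemma Cis_series_scal c a l :
  Cis_series a l -> Cis_series (fun n => c * a n)%C (c * l)%C.
Proof. exact (@is_series_scal C_AbsRing C_NormedModule c a l). Qed.

Lemma Cis_series_minus a b la lb : Cis_series a la -> Cis_series b lb ->
  Cis_series (fun n => a n - b n)%C (la - lb)%C.
Proof. exact (@is_series_minus C_AbsRing C_NormedModule a b la lb). Qed.

Lemma Csum_Re a n : Re (sum_n a n) = sum_n (fun k => Re (a k)) n.
Proof.
induction n as [|n IH]; [now rewrite !sum_O|].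
now rewrite !sum_Sn -IH.
Qed.

Lemma Csum_Im a n : Im (sum_n a n) = sum_n (fun k => Im (a k)) n.
Proof.
induction n as [|n IH]; [now rewrite !sum_O|].
now rewrite !sum_Sn -IH.
Qed.

Lemma CSeries_correct a l : Cis_series a l -> CSeries a = l.
Proof.
intros H; destruct l as [x y]; unfold CSeries; f_equal; apply is_series_unique.
- apply (filterlim_ext (fun n => fst (sum_n a n))); [apply Csum_Re|].
  apply (filterlim_comp _ _ _ _ (fst : C -> R) _ _ _ H).
  exact (@continuous_fst R_UniformSpace R_UniformSpace x y).
- apply (filterlim_ext (fun n => snd (sum_n a n))); [apply Csum_Im|].
  apply (filterlim_comp _ _ _ _ (snd : C -> R) _ _ _ H).
  exact (@continuous_snd R_UniformSpace R_UniformSpace x y).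
Qed.

Lemma Cex_series_abs (a : nat -> C) (b : nat -> R) :
  (forall n, Cmod (a n) <= b n) -> ex_series b -> exists l, Cis_series a l.
Proof. exact (@ex_series_le C_AbsRing C_CompleteNormedModule a b). Qed.

Lemma Csum_S (a : nat -> C) n : (sum_n a (S n) = sum_n a n + a (S n) :> C)%C.
Proof. exact (@sum_Sn C_AbelianMonoid a n). Qed.

(** * Diagonal values of the double series *)

(** When [l] is the sum of [a], this is the remainder [a k + a (k + 1) + ...];
    subtracting terms from [l] makes the telescoping below definitional. *)
Fixpoint Ctail (a : nat -> C) (l : C) (k : nat) : C :=
  match k with
  | O => l
  | S k' => (Ctail a l k' - a k')%C
  end.

Lemma Ctail_correct a l k :
  Cis_series a l -> Cis_series (fun m => a (k + m)%nat) (Ctail a l k).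
Proof.
intros H; induction k as [|k IH]; [exact H|].
apply (Cis_series_ext (fun m => a (k + S m)%nat)); [intros m; f_equal; lia|].
apply (@is_series_incr_1 C_AbsRing C_NormedModule (fun m => a (k + m)%nat)).
change (Cis_series (fun m => a (k + m)%nat) (Ctail a l (S k) + a (k + 0)%nat)).
replace (k + 0)%nat with k by lia.
now replace (Ctail a l (S k) + a k)%C with (Ctail a l k) by (simpl; ring).
Qed.

Lemma Ctail_S a l k : Ctail a l (S k) = (l - sum_n a k)%C.
Proof.
induction k as [|k IH]; [now rewrite sum_O|].
change (Ctail a l (S (S k))) with (Ctail a l (S k) - a (S k))%C.
rewrite IH Csum_S; ring.
Qed.

Lemma Ctail_lim a l : Cis_series a l -> Clim (fun k => Ctail a l (S k)) 0%C.
Proof.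
intros H; apply (Clim_ext (fun k => l - sum_n a k)%C).
{ intros k; now rewrite Ctail_S. }
rewrite -(Cplus_opp_r l).
apply Clim_minus; [apply Clim_const|exact H].
Qed.

(** With [T n] the [n]-th remainder, [a n = T n - T (S n)] gives
    [2 a n T (S n) = T n ^ 2 - T (S n) ^ 2 - a n ^ 2], which telescopes:
    summing over one index strictly above the other halves the square of the
    sum, diagonal removed, and no exchange of summations is required. *)
Lemma series_above_diagonal a l l2 :
  Cis_series a l -> Cis_series (fun n => a n * a n)%C l2 ->
  Cis_series (fun n => a n * Ctail a l (S n))%C ((l * l - l2) / 2)%C.
Proof.
intros H H2.
assert (Hs : forall n, (sum_n (fun n => a n * Ctail a l (S n)) n =
  (l * l - Ctail a l (S n) * Ctail a l (S n)
   - sum_n (fun n => a n * a n) n) / 2 :> C)%C).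
{ assert (two : RtoC 2 <> RtoC 0) by (intros E; injection E; lra).
  intros n; induction n as [|n IH].
  - rewrite !sum_O; simpl Ctail; field; exact two.
  - rewrite !Csum_S IH.
    change (Ctail a l (S (S n))) with (Ctail a l (S n) - a (S n))%C.
    field; exact two. }
apply (Clim_ext _ _ _ (fun n => esym (Hs n))).
apply Clim_mult; [|apply Clim_const].
apply Clim_minus; [|exact H2].
assert (E : (l * l - 0 * 0)%C = (l * l)%C) by ring; rewrite -{2}E.
apply Clim_minus; [apply Clim_const|].
apply Clim_mult; now apply Ctail_lim.
Qed.

(** * The enumeration of the primes *)

Lemma next_primeP m : [/\ (m < next_prime m)%N, prime (next_prime m) &
  forall p, prime p -> (m < p)%N -> (next_prime m <= p)%N].
Proof.
rewrite /next_prime; case: ex_minnP => p /andP[lt_mp pr_p] min_p.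
by split=> // q pr_q lt_mq; apply: min_p; rewrite lt_mq.
Qed.

Lemma nth_prime_prime k : prime (nth_prime k).
Proof. by case: k => [|k] //=; case: (next_primeP (nth_prime k)). Qed.

Lemma nth_prime_ge k : (k.+2 <= nth_prime k)%N.
Proof.
elim: k => [|k IHk] //=; case: (next_primeP (nth_prime k)) => lt_p _ _.
exact: leq_trans lt_p.
Qed.

(** The numbers left after sieving by the first [k] primes, described by a lower
    bound on their prime divisors so that [k] occurs in one place only. *)
Definition rough (k m : nat) : bool := all (leq (nth_prime k)) (primes m).

Lemma rough0 m : rough 0 m.
Proof.
by apply/allP => p; rewrite mem_primes => /andP[/prime_gt1].
Qed.

Lemma rough_dvd k m p : (0 < m)%N -> rough k m -> prime p -> (p %| m)%N ->
  (nth_prime k <= p)%N.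
Proof. by move=> m0 /allP km pr_p pm; apply: km; rewrite mem_primes pr_p m0. Qed.

(** One step of the sieve: no prime lies strictly between two consecutive
    values of [nth_prime]. *)
Lemma roughS k m : (0 < m)%N ->
  rough k.+1 m = rough k m && ~~ (nth_prime k %| m)%N.
Proof.
move=> m0; have [lt_p pr_p min_p] := next_primeP (nth_prime k).
apply/idP/andP => [kSm | [km ndvd]].
  split; last first.
    apply/negP => /(rough_dvd _ _ _ m0 kSm (nth_prime_prime k)).
    by rewrite leqNgt lt_p.
  apply/allP => q; rewrite mem_primes => /and3P[pr_q _ qm].
  exact: leq_trans (ltnW lt_p) (rough_dvd _ _ _ m0 kSm pr_q qm).
apply/allP => q; rewrite mem_primes => /and3P[pr_q _ qm].
apply: min_p => //; rewrite ltn_neqAle (rough_dvd _ _ _ m0 km pr_q qm) andbT.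
by apply: contraNneq ndvd => ->.
Qed.

Lemma rough_mul k j : (0 < j)%N -> rough k (nth_prime k * j) = rough k j.
Proof.
move=> j0; have pr_p := nth_prime_prime k.
apply/allP/allP => km q => [qj | ].
  by apply: km; rewrite (primesM _ (prime_gt0 pr_p) j0) qj orbT.
rewrite (primesM _ (prime_gt0 pr_p) j0) primes_prime // mem_seq1.
by case/orP => [/eqP->|/km].
Qed.

Lemma rough1 k : rough k 1.
Proof. by []. Qed.

Lemma rough_small k m : (1 < m < nth_prime k)%N -> rough k m = false.
Proof.
case/andP => m1 m_lt; apply/negP => km.
have := rough_dvd _ _ _ (ltnW m1) km (pdiv_prime m1) (pdiv_dvd m).
by rewrite leqNgt (leq_ltn_trans (pdiv_leq (ltnW m1)) m_lt).
Qed.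

(** * The Euler product *)

Fixpoint Cprod (u : nat -> C) (n : nat) : C :=
  match n with
  | O => 1%C
  | S k => (Cprod u k * u k)%C
  end.

Lemma Cprod_mul u v n :
  Cprod (fun i => u i * v i)%C n = (Cprod u n * Cprod v n)%C.
Proof. induction n as [|n IH]; simpl; [|rewrite IH]; ring. Qed.

Lemma Cprod_ext u v n : (forall i, u i = v i) -> Cprod u n = Cprod v n.
Proof. intros E; induction n as [|n IH]; simpl; congruence. Qed.

Lemma Cprod_head u n : Cprod u (S n) = (u 0%nat * Cprod (fun i => u (S i)) n)%C.
Proof.
induction n as [|n IH]; [simpl; ring|].
change (Cprod u (S (S n))) with (Cprod u (S n) * u (S n))%C.
rewrite IH; simpl; ring.
Qed.

(** The partial sum up to [n] of the dilated series is the partial sum up to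
    [n %/ p] of the original one. *)
Lemma series_dilate p c l : (0 < p)%N -> Cis_series c l ->
  Cis_series (fun m => if (p %| m)%N then c (m %/ p)%N else 0%C) l.
Proof.
move=> p0 Hc.
have Hs n : sum_n c (n %/ p)%N =
    sum_n (fun m => if (p %| m)%N then c (m %/ p)%N else 0%C) n :> C.
  elim: n => [|n IHn]; first by rewrite div0n !sum_O dvdn0 div0n.
  rewrite Csum_S -IHn divnS //; case: (p %| n.+1)%N.
    by rewrite add1n Csum_S.
  by rewrite add0n Cplus_0_r.
apply: (Clim_ext _ _ _ Hs).
apply: (filterlim_comp _ _ _ (fun n => n %/ p)%N _ _ eventually); last exact: Hc.
move=> P [N HN]; exists (N * p)%N => n /leP le_n; apply: HN; apply/leP.
by rewrite leq_divRL.
Qed.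

Definition completely_multiplicative (f : nat -> C) : Prop :=
  f 0%nat = 0%C /\ f 1%nat = 1%C /\ forall m n, f (m * n)%N = (f m * f n)%C.

Definition sieve (f : nat -> C) (k m : nat) : C := if rough k m then f m else 0%C.

(** Among the terms that survive [k] steps, those that the next step removes
    have index [p * j], where [p = nth_prime k] and [j] itself survives [k] steps;
    by multiplicativity they add up to [f p * l]. *)
Lemma sieve_step f k l : completely_multiplicative f ->
  Cis_series (sieve f k) l ->
  Cis_series (sieve f k.+1) (l * (1 - f (nth_prime k)))%C.
Proof.
case=> f0 [f1 fM] Hl; set p := nth_prime k.
have p0 : (0 < p)%N := prime_gt0 (nth_prime_prime k).
have := Cis_series_minus _ _ _ _ Hl
  (series_dilate p _ _ p0 (Cis_series_scal (f p) _ _ Hl)).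
have -> : (l - f p * l)%C = (l * (1 - f p))%C by ring.
apply: Cis_series_ext => m; rewrite /sieve; cbv beta.
have [->|m_gt0] := posnP m.
  by rewrite dvdn0 div0n f0; do 2!case: (rough _ _); ring.
rewrite roughS // -/p; have [pm|_] /= := boolP (p %| m)%N; last first.
  by rewrite andbT; case: (rough _ _); ring.
have j0 : (0 < m %/ p)%N by rewrite divn_gt0 // dvdn_leq.
rewrite andbF -{1 2}(divnK pm) mulnC rough_mul // -/p.
by case: (rough k _); rewrite ?fM; ring.
Qed.

Lemma sieve_lim f l k : completely_multiplicative f -> Cis_series f l ->
  Cis_series (sieve f k) (l * Cprod (fun i => 1 - f (nth_prime i)) k)%C.
Proof.
move=> fcm Hl; elim: k => [|k IHk].
  have -> : (l * Cprod (fun i => 1 - f (nth_prime i)) 0)%C = l by simpl; ring.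
  by apply: Cis_series_ext Hl => m; rewrite /sieve rough0.
have := sieve_step _ _ _ fcm IHk; congr Cis_series; simpl; ring.
Qed.

Lemma sieve_sum_small (f : nat -> C) k n : f 0%nat = 0%C -> f 1%nat = 1%C ->
  (0 < n < nth_prime k)%N -> sum_n (sieve f k) n = 1%C :> C.
Proof.
move=> f0 f1; elim: n => [|n IHn] //= lt_n.
rewrite Csum_S; have [n0|n_gt0] := posnP n.
  by rewrite n0 sum_O /sieve rough1 f0 f1; case: (rough _ _); rewrite Cplus_0_l.
rewrite IHn; last by rewrite n_gt0 (ltnW lt_n).
by rewrite /sieve rough_small ?Cplus_0_r // ltnS n_gt0.
Qed.

Lemma sieve_dist (f : nat -> C) k j : f 0%nat = 0%C -> f 1%nat = 1%C ->
  Cmod (sum_n (sieve f k) (k.+1 + j)%N - 1)%C <=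
  sum_n (fun m => Cmod (f m)) (k.+1 + j)%N - sum_n (fun m => Cmod (f m)) k.+1.
Proof.
move=> f0 f1; elim: j => [|j IHj].
  rewrite addn0 sieve_sum_small ?nth_prime_ge //.
  by rewrite /Cminus Cplus_opp_r Cmod_0; lra.
rewrite addnS Csum_S sum_Sn /plus /=.
set n := (k.+1 + j)%N in IHj *.
have -> : (sum_n (sieve f k) n + sieve f k n.+1 - 1 =
  (sum_n (sieve f k) n - 1) + sieve f k n.+1)%C by ring.
apply: Rle_trans (Cmod_triangle _ _) _.
have : Cmod (sieve f k n.+1) <= Cmod (f n.+1).
  rewrite /sieve; case: (rough _ _); first lra.
  by rewrite Cmod_0; apply: Cmod_ge_0.
by change (k.+1 + j)%coq_nat with n; lra.
Qed.

(** The partial products are the sums of the sieved series: after [k] steps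
    the surviving indices are [1] and numbers beyond [k + 1], so what is left of
    the sum differs from [1] by at most a remainder of the series of absolute
    values. *)
Lemma euler_product (f : nat -> C) l : completely_multiplicative f ->
  ex_series (fun m => Cmod (f m)) -> Cis_series f l ->
  Clim (fun k => l * Cprod (fun i => 1 - f (nth_prime i)) k)%C 1%C.
Proof.
move=> fcm [B HB] Hl; have [f0 [f1 _]] := fcm.
have HB' : is_lim_seq (sum_n (fun m => Cmod (f m))) B by exact: HB.
apply: (Clim_bound _ _ (fun k => B - sum_n (fun m => Cmod (f m)) k.+1)); last first.
  rewrite -(Rminus_diag B).
  apply: is_lim_seq_minus'; first exact: is_lim_seq_const.
  by apply: (is_lim_seq_incr_1 (sum_n (fun m => Cmod (f m))) B).1.
move=> k.
have H1 := Clim_Cmod _ _ (Clim_minus _ _ _ _ (Cis_series_lim _ _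
  (sieve_lim f l k fcm Hl)) (Clim_const 1%C)).
have H2 := is_lim_seq_minus' _ _ _ _ HB'
  (is_lim_seq_const (sum_n (fun m => Cmod (f m)) k.+1)).
apply: (is_lim_seq_le_loc _ _ _ _ _ H1 H2).
exists k.+1 => n /leP le_n; rewrite -(subnKC le_n); exact: sieve_dist.
Qed.

(** * Powers of the integers *)

Lemma Cexp_plus a b : Cexp (a + b)%C = (Cexp a * Cexp b)%C.
Proof.
destruct a as [x y], b as [u v]; unfold Cexp, Re, Im; simpl.
rewrite exp_plus cos_plus sin_plus; unfold Cmult; simpl; f_equal; ring.
Qed.

Lemma Cmod_Cexp z : Cmod (Cexp z) = exp (Re z).
Proof.
unfold Cmod, Cexp; simpl.
replace (_ + _) with (exp (Re z) ^ 2).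
{ rewrite sqrt_pow2; [easy|left; apply exp_pos]. }
pose proof (sin2_cos2 (Im z)) as H; unfold Rsqr in H; nra.
Qed.

Lemma Cmod_Cpower x s : Cmod (Cpower x s) = Rpower x (Re s).
Proof.
unfold Cpower, Rpower; rewrite Cmod_Cexp; f_equal.
destruct s as [a b]; simpl; ring.
Qed.

Lemma Rpower_gt0 x a : 0 < Rpower x a.
Proof. apply exp_pos. Qed.

Lemma Cpower_neq0 x s : Cpower x s <> RtoC 0.
Proof.
apply Cmod_gt_0; rewrite Cmod_Cpower; apply Rpower_gt0.
Qed.

Lemma Cpower_mult x y s : 0 < x -> 0 < y ->
  Cpower (x * y) s = (Cpower x s * Cpower y s)%C.
Proof.
intros Hx Hy; unfold Cpower; rewrite -Cexp_plus ln_mult // RtoC_plus.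
f_equal; ring.
Qed.

(** The power [m ^ (- s)]; the value [0] at [m = 0] makes it completely
    multiplicative on all of [nat] and leaves the sum unaffected. *)
Definition inv_power (s : C) (m : nat) : C :=
  if m is O then RtoC 0 else (/ Cpower (INR m) s)%C.

Lemma inv_powerS s m : inv_power s (S m) = (/ Cpower (INR (S m)) s)%C.
Proof. reflexivity. Qed.

Lemma INR_S_gt0 n : 0 < INR (S n).
Proof. apply lt_0_INR; lia. Qed.

Lemma Cmod_inv_power s m : Cmod (inv_power s (S m)) = Rpower (INR (S m)) (- Re s).
Proof.
rewrite inv_powerS Cmod_inv; [|apply Cpower_neq0].
now rewrite Cmod_Cpower Rpower_Ropp.
Qed.

Lemma inv_power_multiplicative s : completely_multiplicative (inv_power s).
Proof.
split; [easy|split].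
- rewrite inv_powerS; unfold Cpower; simpl INR; rewrite ln_1 Cmult_0_r.
  unfold Cexp; simpl; rewrite exp_0 cos_0 sin_0 Rmult_1_r Rmult_0_r.
  change (/ RtoC 1 = RtoC 1)%C; field; intros E; injection E; lra.
- intros [|m] n; [rewrite mul0n; simpl; ring|].
  destruct n as [|n]; [rewrite muln0; simpl; ring|].
  replace (S m * S n)%N with (S (n + m * S n)) by lia.
  rewrite !inv_powerS; replace (S (n + m * S n)) with (S m * S n)%coq_nat by lia.
  rewrite mult_INR Cpower_mult; [|apply INR_S_gt0|apply INR_S_gt0].
  field; split; apply Cpower_neq0.
Qed.

Lemma square_multiplicative f : completely_multiplicative f ->
  completely_multiplicative (fun m => f m * f m)%C.
Proof.
intros [f0 [f1 fM]]; split; [|split].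
- rewrite f0; ring.
- rewrite f1; ring.
- intros m n; rewrite fM; ring.
Qed.

Lemma Rpower_telescope d x : 0 < d -> 0 < x ->
  d * Rpower (x + 1) (- (1 + d)) <= Rpower x (- d) - Rpower (x + 1) (- d).
Proof.
intros Hd Hx.
assert (Hx1 : 0 < x + 1) by lra.
replace (- (1 + d)) with (- d + - (1)) by ring.
rewrite Rpower_plus (Rpower_Ropp _ 1) Rpower_1 //.
assert (H1 : / (x + 1) <= ln (x + 1) - ln x).
{ assert (Hq : 0 < x / (x + 1)) by (apply Rdiv_lt_0_compat; lra).
  pose proof (exp_ineq1_le (ln (x / (x + 1)))) as H.
  rewrite exp_ln // ln_div // in H.
  replace (x / (x + 1)) with (1 - / (x + 1)) in H by (field; lra); lra. }
assert (H2 : Rpower x (- d) = Rpower (x + 1) (- d) * exp (d * (ln (x + 1) - ln x))).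
{ unfold Rpower; rewrite -exp_plus; f_equal; ring. }
pose proof (exp_ineq1_le (d * (ln (x + 1) - ln x))) as H3.
pose proof (Rpower_gt0 (x + 1) (- d)) as H4.
rewrite H2; set (P := Rpower (x + 1) (- d)) in *.
set (L := ln (x + 1) - ln x) in *.
assert (d * / (x + 1) <= d * L) by (apply Rmult_le_compat_l; lra).
replace (d * (P * / (x + 1))) with (P * (d * / (x + 1))) by ring.
replace (P * exp (d * L) - P) with (P * (exp (d * L) - 1)) by ring.
apply Rmult_le_compat_l; lra.
Qed.

Lemma ex_series_Rpower sigma : 1 < sigma ->
  ex_series (fun n => Rpower (INR (S n)) (- sigma)).
Proof.
intros Hs; set (d := sigma - 1); assert (Hd : 0 < d) by (unfold d; lra).
set (a := fun n => Rpower (INR (S n)) (- sigma)).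
destruct (ex_finite_lim_seq_incr (sum_n a) (1 + / d)) as [l Hl]; [| |exists l; exact Hl].
{ intros n; rewrite sum_Sn; unfold plus; simpl.
  pose proof (Rpower_gt0 (INR (S (S n))) (- sigma)); unfold a; lra. }
assert (H : forall n, sum_n a n <= 1 + / d * (1 - Rpower (INR (S n)) (- d))).
{ intros n; induction n as [|n IH].
  - rewrite sum_O; unfold a; simpl INR; unfold Rpower.
    rewrite ln_1 !Rmult_0_r exp_0; lra.
  - rewrite sum_Sn; change (sum_n a n + a (S n) <=
      1 + / d * (1 - Rpower (INR (S (S n))) (- d))).
    pose proof (Rpower_telescope d (INR (S n)) Hd (INR_S_gt0 n)) as H.
    rewrite -S_INR in H; replace (1 + d) with sigma in H by (unfold d; ring).
    change (Rpower (INR (S (S n))) (- sigma)) with (a (S n)) in H.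
    set (P := Rpower (INR (S n)) (- d)) in *.
    set (Q := Rpower (INR (S (S n))) (- d)) in *.
    assert (a (S n) <= / d * (P - Q)); [|nra].
    apply (Rmult_le_reg_l d); [lra|].
    rewrite -Rmult_assoc Rinv_r; lra. }
intros n; apply (Rle_trans _ _ _ (H n)).
pose proof (Rpower_gt0 (INR (S n)) (- d)).
assert (0 < / d) by now apply Rinv_0_lt_compat.
nra.
Qed.

Lemma inv_power_summable s : 1 < Re s ->
  ex_series (fun m => Cmod (inv_power s m)).
Proof.
intros Hs; apply ex_series_incr_1.
apply (ex_series_ext (fun n => Rpower (INR (S n)) (- Re s))).
{ intros n; now rewrite Cmod_inv_power. }
now apply ex_series_Rpower.
Qed.

(** In terms of [f m = m ^ (- s)] the inner series is [f n1] times the remainder of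
    the series of [f] beyond [n1], so the double series is a sum over one index
    strictly above the other. *)
Lemma zeta2_diagonal s l l2 :
  Cis_series (inv_power s) l ->
  Cis_series (fun m => inv_power s m * inv_power s m)%C l2 ->
  zeta2 s s = ((l * l - l2) / 2)%C.
Proof.
intros Hl Hl2; unfold zeta2.
apply CSeries_correct.
set (f := inv_power s) in *.
apply (Cis_series_ext (fun n => f (S n) * Ctail f l (S (S n)))%C).
{ intros n1; symmetry; apply CSeries_correct.
  apply (Cis_series_ext (fun n2 => f (S n1) * f (S (S n1) + n2)%nat)%C).
  - intros n2.
    replace (S (S n1) + n2)%nat with (S (S (n1 + n2))) by lia.
    replace (S n1 + S n2)%coq_nat with (S (S (n1 + n2))) by lia.
    unfold f; rewrite !inv_powerS; field; split; apply Cpower_neq0.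
  - apply Cis_series_scal; now apply Ctail_correct. }
apply (@is_series_incr_1 C_AbsRing C_NormedModule
  (fun n => f n * Ctail f l (S n))%C).
change (Cis_series (fun n => f n * Ctail f l (S n))%C
  ((l * l - l2) / 2 + f 0%nat * Ctail f l 1)%C).
replace (f 0%nat) with (RtoC 0) by reflexivity.
rewrite Cmult_0_l Cplus_0_r.
now apply series_above_diagonal.
Qed.

(** * Addition of arguments *)

(** [x = V / U] is the hyperbolic tangent of half the logarithm of
    [(U + V) / (U - V)], and multiplying that quotient by [(1 + z) / (1 - z)]
    replaces [x] by [(x + z) / (1 + x z)].  Here [|x + z| <= |x| + |z|] and
    [|1 + x z| >= 1 - |x| |z|], which gives the addition theorem of [tan].  The
    factor [mu] comes out of the numerator; in the denominator it is dropped, as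
    [1 - mu ^ 2 * t * u >= 1 - t * u]. *)
Lemma tanh_add_le_tan_add (U V z : C) (mu t u : R) :
  0 <= mu <= 1 -> 0 <= t -> 0 <= u -> t * u < 1 ->
  Cmod V <= mu * t * Cmod U -> Cmod z <= mu * u ->
  Cmod (V + z * U)%C <= mu * ((t + u) / (1 - t * u)) * Cmod (U + z * V)%C.
Proof.
intros Hmu Ht Hu Htu HV Hz.
pose proof (Cmod_ge_0 U) as HU0; pose proof (Cmod_ge_0 V) as HV0.
pose proof (Cmod_ge_0 z) as Hz0.
assert (HzV : Cmod z * Cmod V <= t * u * Cmod U).
{ apply Rle_trans with ((mu * u) * (mu * t * Cmod U)).
  - apply Rmult_le_compat; assumption.
  - assert (mu * mu <= 1) by nra.
    assert (0 <= t * u * Cmod U) by (repeat apply Rmult_le_pos; assumption).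
    nra. }
assert (Hnum : Cmod (V + z * U)%C <= mu * (t + u) * Cmod U).
{ apply (Rle_trans _ _ _ (Cmod_triangle _ _)); rewrite Cmod_mult.
  assert (Cmod z * Cmod U <= mu * u * Cmod U) by (apply Rmult_le_compat_r; assumption).
  lra. }
assert (Hden : (1 - t * u) * Cmod U <= Cmod (U + z * V)%C).
{ assert (H : Cmod U <= Cmod (U + z * V)%C + Cmod z * Cmod V).
  { rewrite -Cmod_mult -(Cmod_opp (z * V)%C).
    replace U with ((U + z * V) + - (z * V))%C at 1 by ring.
    apply Cmod_triangle. }
  lra. }
apply (Rle_trans _ _ _ Hnum).
replace (mu * ((t + u) / (1 - t * u)) * Cmod (U + z * V)%C)
  with (mu * (t + u) * (Cmod (U + z * V)%C / (1 - t * u))) by (field; lra).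
apply Rmult_le_compat_l; [nra|].
apply (Rmult_le_reg_r (1 - t * u)); [lra|].
replace (Cmod (U + z * V)%C / (1 - t * u) * (1 - t * u))
  with (Cmod (U + z * V)%C) by (field; lra).
lra.
Qed.

Lemma tan_add_nonneg a b : 0 <= a -> 0 <= b -> a + b < PI / 2 ->
  tan a * tan b < 1 /\ tan (a + b) = (tan a + tan b) / (1 - tan a * tan b).
Proof.
intros Ha Hb Hab.
assert (Ca : 0 < cos a) by (apply cos_gt_0; lra).
assert (Cb : 0 < cos b) by (apply cos_gt_0; lra).
assert (Cab : 0 < cos (a + b)) by (apply cos_gt_0; lra).
assert (H : tan a * tan b < 1).
{ rewrite cos_plus in Cab; unfold tan.
  apply (Rmult_lt_reg_r (cos a * cos b)); [nra|].
  replace (sin a / cos a * (sin b / cos b) * (cos a * cos b))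
    with (sin a * sin b) by (field; lra).
  lra. }
split; [exact H|apply tan_plus; lra].
Qed.

Lemma tan_mono a b : 0 <= a -> a <= b -> b < PI / 2 -> tan a <= tan b.
Proof.
intros Ha [Hab| ->] Hb; [|apply Rle_refl].
left; apply tan_increasing; lra.
Qed.

Lemma atan_ge0 x : 0 <= x -> 0 <= atan x.
Proof.
intros [Hx| <-]; [|rewrite atan_0; apply Rle_refl].
left; rewrite -atan_0; now apply atan_increasing.
Qed.

Lemma atan_le x : 0 <= x -> atan x <= x.
Proof.
intros [Hx| <-]; [|rewrite atan_0; apply Rle_refl].
destruct (MVT_gen atan 0 x (fun t => / (1 + Rsqr t))) as [c [_ Hc]].
{ intros t _; apply is_derive_atan. }
{ intros t _; apply continuity_pt_filterlim, continuous_atan. }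
rewrite atan_0 !Rminus_0_r in Hc; rewrite Hc -{2}(Rmult_1_l x).
apply Rmult_le_compat_r; [lra|].
rewrite -Rinv_1; apply Rinv_le_contravar; pose proof (Rle_0_sqr c); lra.
Qed.

Lemma sum_n_nonneg (a : nat -> R) n : (forall i, 0 <= a i) -> 0 <= sum_n a n.
Proof.
intros Ha; induction n as [|n IH]; [rewrite sum_O; apply Ha|].
rewrite sum_Sn; apply Rplus_le_le_0_compat; [exact IH|apply Ha].
Qed.

(** Subadditivity of angles for the product [N / D] of the factors
    [(1 + z i) / (1 - z i)], whose [Z = (N - D) / (N + D)].  The inequality is
    cleared of denominators, so that nothing has to be known to be nonzero. *)
Lemma prod_tanh_bound (z : nat -> C) (y : nat -> R) (mu : R) (n : nat) :
  0 <= mu <= 1 -> (forall i, 0 <= y i) -> (forall i, Cmod (z i) <= mu * y i) ->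
  sum_n (fun i => atan (y i)) n < PI / 2 ->
  Cmod (Cprod (fun i => 1 + z i) (S n) - Cprod (fun i => 1 - z i) (S n))%C <=
  mu * tan (sum_n (fun i => atan (y i)) n) *
  Cmod (Cprod (fun i => 1 + z i) (S n) + Cprod (fun i => 1 - z i) (S n))%C.
Proof.
intros Hmu Hy Hz; induction n as [|n IH]; intros Hn.
- rewrite sum_O tan_atan; simpl.
  replace (1 * (1 + z 0%N) - 1 * (1 - z 0%N))%C with (z 0%N * 2)%C by ring.
  replace (1 * (1 + z 0%N) + 1 * (1 - z 0%N))%C with (RtoC 2) by ring.
  rewrite Cmod_mult; apply Rmult_le_compat_r; [apply Cmod_ge_0|apply Hz].
- rewrite sum_Sn in Hn |- *.
  set (A := sum_n (fun i => atan (y i)) n) in *.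
  change (plus A (atan (y (S n)))) with (A + atan (y (S n))) in *.
  assert (HA : 0 <= A) by (apply sum_n_nonneg; intros i; now apply atan_ge0).
  assert (Hb : 0 <= atan (y (S n))) by now apply atan_ge0.
  destruct (tan_add_nonneg A (atan (y (S n))) HA Hb Hn) as [Ht E].
  assert (HtA : 0 <= tan A) by (rewrite -tan_0; apply tan_mono; lra).
  rewrite E tan_atan; rewrite tan_atan in Ht.
  assert (HA2 : A < PI / 2) by lra; specialize (IH HA2).
  change (Cprod (fun i => 1 + z i)%C (S (S n)))
    with (Cprod (fun i => 1 + z i) (S n) * (1 + z (S n)))%C.
  change (Cprod (fun i => 1 - z i)%C (S (S n)))
    with (Cprod (fun i => 1 - z i) (S n) * (1 - z (S n)))%C.
  set (N := Cprod (fun i => 1 + z i)%C (S n)) in *.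
  set (D := Cprod (fun i => 1 - z i)%C (S n)) in *.
  pose proof (tanh_add_le_tan_add (N + D) (N - D) (z (S n)) mu (tan A) (y (S n))
    Hmu HtA (Hy _) Ht IH (Hz _)) as H.
  replace (N * (1 + z (S n)) - D * (1 - z (S n)))%C
    with (N - D + z (S n) * (N + D))%C by ring.
  now replace (N * (1 + z (S n)) + D * (1 - z (S n)))%C
    with (N + D + z (S n) * (N - D))%C by ring.
Qed.

Lemma sum_n_le_Series (a : nat -> R) n :
  (forall i, 0 <= a i) -> ex_series a -> sum_n a n <= Series a.
Proof.
intros Ha Hex; apply (is_lim_seq_incr_compare (sum_n a)).
- exact (Series_correct _ Hex).
- intros k; rewrite sum_Sn; unfold plus; simpl; specialize (Ha (S k)); lra.
Qed.

(** If the whole product equals [1], its first factor is the inverse of the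
    product of the others, so its argument is bounded by the sum of theirs. *)
Lemma first_factor_bound (z c : nat -> C) (y : nat -> R) (mu x : R) :
  0 <= mu <= 1 -> 0 <= x -> (forall i, 0 <= y i) ->
  (forall i, Cmod (z (S i)) <= mu * y i) ->
  ex_series (fun i => atan (y i)) -> Series (fun i => atan (y i)) <= atan x ->
  Clim (fun k => c k * Cprod (fun i => 1 + z i) k)%C 1%C ->
  Clim (fun k => c k * Cprod (fun i => 1 - z i) k)%C 1%C ->
  Cmod (z 0%nat) <= mu * x.
Proof.
intros Hmu Hx Hy Hz Hex Hser HN HD.
set (N := Cprod (fun i => 1 + z (S i))%C); set (D := Cprod (fun i => 1 - z (S i))%C).
assert (Hb : forall n,
  Cmod (N (S n) - D (S n))%C <= mu * x * Cmod (N (S n) + D (S n))%C).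
{ intros n.
  assert (Hat : forall i, 0 <= atan (y i)) by (intros i; now apply atan_ge0).
  assert (Hle : sum_n (fun i => atan (y i)) n <= atan x).
  { apply (Rle_trans _ (Series (fun i => atan (y i)))); [|exact Hser].
    now apply sum_n_le_Series. }
  pose proof (atan_bound x) as Hax.
  apply (Rle_trans _ _ _ (prod_tanh_bound (fun i => z (S i)) y mu n Hmu Hy Hz
    ltac:(lra))).
  apply Rmult_le_compat_r; [apply Cmod_ge_0|].
  apply Rmult_le_compat_l; [lra|].
  rewrite -(tan_atan x); apply tan_mono; [|exact Hle|lra].
  now apply sum_n_nonneg. }
set (z0 := z 0%nat) in *.
assert (HN' := Clim_mult _ _ _ _ (Clim_shift _ _ (Clim_shift _ _ HN))
  (Clim_const (1 - z0)%C)).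
assert (HD' := Clim_mult _ _ _ _ (Clim_shift _ _ (Clim_shift _ _ HD))
  (Clim_const (1 + z0)%C)).
pose proof (fun Hle => is_lim_seq_le _ _ _ _ Hle
  (Clim_Cmod _ _ (Clim_minus _ _ _ _ HN' HD'))
  (is_lim_seq_scal_l _ (mu * x) _ (Clim_Cmod _ _ (Clim_plus _ _ _ _ HN' HD')))) as Hlim.
cbn [Rbar_le Rbar_mult Rbar_mult'] in Hlim; cbv beta in Hlim.
replace (1 * (1 - z0) - 1 * (1 + z0))%C with (- (z0 * 2))%C in Hlim by ring.
replace (1 * (1 - z0) + 1 * (1 + z0))%C with (RtoC 2) in Hlim by ring.
rewrite Cmod_opp Cmod_mult Cmod_R Rabs_pos_eq in Hlim; [|lra].
enough (Cmod z0 * 2 <= mu * x * 2) by lra.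
apply Hlim; intros n.
(* Both sides acquire the common factor [c (1 + z 0) (1 - z 0)]. *)
set (m := (c (S (S n)) * (1 + z0) * (1 - z0))%C).
rewrite (Cprod_head (fun i => 1 + z i)%C) (Cprod_head (fun i => 1 - z i)%C).
fold z0; fold N; fold D.
replace (c (S (S n)) * ((1 + z0) * N (S n)) * (1 - z0) -
  c (S (S n)) * ((1 - z0) * D (S n)) * (1 + z0))%C
  with (m * (N (S n) - D (S n)))%C by (unfold m; ring).
replace (c (S (S n)) * ((1 + z0) * N (S n)) * (1 - z0) +
  c (S (S n)) * ((1 - z0) * D (S n)) * (1 + z0))%C
  with (m * (N (S n) + D (S n)))%C by (unfold m; ring).
rewrite 2!(Cmod_mult m) -Rmult_assoc (Rmult_comm (mu * x)) Rmult_assoc.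
apply Rmult_le_compat_l; [apply Cmod_ge_0|apply Hb].
Qed.

(** * The zero-free half-plane *)

Lemma nth_prime_INR_ge k i : (k <= i)%N -> INR (S (S k)) <= INR (nth_prime i).
Proof. intros H; apply le_INR; pose proof (nth_prime_ge i); lia. Qed.

Lemma Rpower_neg_le x y a : 0 <= a -> 0 < x -> x <= y -> Rpower y (- a) <= Rpower x (- a).
Proof.
intros Ha Hx Hxy; rewrite !Rpower_Ropp.
apply Rinv_le_contravar; [apply Rpower_gt0|].
now apply Rle_Rpower_l.
Qed.

Lemma ex_series_atan_prime sigma : 1 < sigma ->
  ex_series (fun n => atan (Rpower (INR (nth_prime (S n))) (- sigma))).
Proof.
intros Hs; apply (@ex_series_le R_AbsRing R_CompleteNormedModule _
  (fun n => Rpower (INR (S n)) (- sigma))); [|now apply ex_series_Rpower].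
intros n; change norm with Rabs; cbv beta.
pose proof (Rpower_gt0 (INR (nth_prime (S n))) (- sigma)) as H0.
rewrite Rabs_pos_eq; [|apply atan_ge0; lra].
apply (Rle_trans _ (Rpower (INR (nth_prime (S n))) (- sigma))); [apply atan_le; lra|].
apply Rpower_neg_le; [lra|apply INR_S_gt0|].
apply le_INR; pose proof (nth_prime_ge (S n)); lia.
Qed.

Theorem theorem1 (sigma_b : R) (sigma_b_gt1 : 1 < sigma_b)
  (g_sigma_b : g sigma_b = 0) (s : C) (Hs : sigma_b < Re s) :
  zeta2 s s <> RtoC 0.
Proof.
intros H0; set (f := inv_power s).
assert (Hs1 : 1 < Re s) by lra.
assert (fcm : completely_multiplicative f) by apply inv_power_multiplicative.
assert (Habs : ex_series (fun m => Cmod (f m))) by now apply inv_power_summable.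
assert (f_le1 : forall m, Cmod (f m) <= 1).
{ intros [|m]; [simpl; rewrite Cmod_0; lra|].
  unfold f; rewrite Cmod_inv_power.
  apply (Rle_trans _ (Rpower 1 (- Re s))).
  - apply Rpower_neg_le; [lra|lra|]; rewrite S_INR; pose proof (pos_INR m); lra.
  - unfold Rpower; rewrite ln_1 Rmult_0_r exp_0; lra. }
assert (Habs2 : ex_series (fun m => Cmod (f m * f m)%C)).
{ apply (@ex_series_le R_AbsRing R_CompleteNormedModule _ (fun m => Cmod (f m)));
    [|exact Habs].
  intros m; change norm with Rabs; cbv beta.
  rewrite Cmod_mult; pose proof (Cmod_ge_0 (f m)); pose proof (f_le1 m).
  rewrite Rabs_pos_eq; nra. }
destruct (Cex_series_abs f _ (fun m => Rle_refl _) Habs) as [l Hl].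
destruct (Cex_series_abs (fun m => f m * f m)%C _ (fun m => Rle_refl _) Habs2)
  as [l2 Hl2].
(* A zero of the double zeta-function makes [zeta s ^ 2 = zeta (2 s)]. *)
assert (E : (l * l)%C = l2).
{ rewrite (zeta2_diagonal s l l2 Hl Hl2) in H0.
  assert (two : RtoC 2 <> RtoC 0) by (intros E; injection E; lra).
  replace (l * l)%C with ((l * l - l2) / 2 * 2 + l2)%C by (field; exact two).
  rewrite H0; ring. }
set (z := fun i => f (nth_prime i)).
assert (HE := euler_product f l fcm Habs Hl).
assert (HE2 := euler_product _ l2 (square_multiplicative f fcm) Habs2 Hl2).
set (c := fun k => (l * l * Cprod (fun i => 1 - z i) k)%C).
assert (HD : Clim (fun k => c k * Cprod (fun i => 1 - z i) k)%C 1%C).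
{ pose proof (Clim_mult _ _ _ _ HE HE) as H; rewrite Cmult_1_l in H.
  refine (Clim_ext _ _ _ _ H).
  intros k; unfold c, z; ring. }
(* [(1 - z i) (1 + z i) = 1 - f (p ^ 2)], so this is the Euler product of [l2]. *)
assert (HN : Clim (fun k => c k * Cprod (fun i => 1 + z i) k)%C 1%C).
{ apply (Clim_ext (fun k => l2 * Cprod (fun i => 1 - f (nth_prime i) * f (nth_prime i)) k)%C);
    [|exact HE2].
  intros k; unfold c; rewrite -E -(Cmult_assoc (l * l)%C) -Cprod_mul; f_equal.
  apply Cprod_ext; intros i; unfold z; ring. }
(* [3] is the least prime other than [2]. *)
set (d := Re s - sigma_b).
set (mu := Rpower 3 (- d)); set (x := Rpower 2 (- sigma_b)).
set (y := fun i => Rpower (INR (nth_prime (S i))) (- sigma_b)).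
assert (Hx : 0 < x) by apply Rpower_gt0.
assert (Hmod : forall i, Cmod (z i) =
  Rpower (INR (nth_prime i)) (- d) * Rpower (INR (nth_prime i)) (- sigma_b)).
{ intros i; rewrite -Rpower_plus; replace (- d + - sigma_b) with (- Re s) by (unfold d; ring).
  unfold z, f; pose proof (nth_prime_ge i).
  destruct (nth_prime i) as [|p]; [lia|apply Cmod_inv_power]. }
assert (Hmu : 0 < mu < Rpower 2 (- d)).
{ split; [apply Rpower_gt0|]; unfold mu; rewrite !Rpower_Ropp.
  apply Rinv_lt_contravar; [apply Rmult_lt_0_compat; apply Rpower_gt0|].
  apply Rlt_Rpower_l; unfold d; lra. }
assert (Hmu1 : Rpower 2 (- d) <= 1).
{ rewrite -(Rpower_O 2); [|lra]; apply Rle_Rpower; unfold d; lra. }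
assert (Hser : Series (fun i => atan (y i)) = atan x).
{ unfold g, theta in g_sigma_b; rewrite Series_scal_l in g_sigma_b.
  change (INR (nth_prime 0)) with (INR 2) in g_sigma_b; simpl (INR 2) in g_sigma_b.
  unfold x, y; replace 2 with (1 + 1) at 1 by ring; simpl in *; lra. }
assert (H : Cmod (z 0%nat) <= mu * x).
{ apply (first_factor_bound z c y mu x); try assumption; try lra.
  - intros i; left; apply Rpower_gt0.
  - intros i; rewrite Hmod; apply Rmult_le_compat_r; [left; apply Rpower_gt0|].
    apply Rpower_neg_le; [unfold d; lra|lra|].
    replace 3 with (INR 3) by (simpl; ring); now apply nth_prime_INR_ge.
  - now apply ex_series_atan_prime. }
rewrite Hmod in H; change (INR (nth_prime 0)) with (1 + 1) in H.
replace (1 + 1) with 2 in H by ring; fold x in H.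
assert (mu * x < Rpower 2 (- d) * x) by (apply Rmult_lt_compat_r; lra).
lra.
Qed.
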